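(* Let $n\ge 1$, let $T\subset\mathbb{R}^n$ be a simplex with vertices $\mathbf{v}_0,\dots,\mathbf{v}_n$, let $f:T\to\mathbb{R}$ be a convex function, and let $g:T\to\mathbb{R}$ be a nonnegative integrable function such that, for a certain cyclic permutation $\sigma$ of order $n+1$ of the set $\{0,\dots,n\}$ (that is, a cycle of length $n+1$), $g(\sigma(\mathbf{x}))=g(\mathbf{x})$ holds for all $\mathbf{x}\in T$. Then $$0\le \Delta(f,T)\int_T g(\mathbf{x})\cdot (n+1)\min_{0\le j\le n}\{\xi_j\}\,d\mathbf{x}\le \mathcal{R}(f,T;g)$$ and $$0\le \mathcal{L}(f,T;g)\le \Delta(f,T)\int_T g(\mathbf{x})\cdot\bigl(1-(n+1)\min_{0\le j\le n}\{\xi_j\}\bigr)\,d\mathbf{x},$$ where $(\xi_0,\dots,\xi_n)$ denote the barycentric coordinates of $\mathbf{x}\in T$.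
   Context: The convex hull $T$ of $n+1$ points $\mathbf{v}_0,\dots,\mathbf{v}_n\in\mathbb{R}^n$ is called a simplex, with vertices $\mathbf{v}_0,\dots,\mathbf{v}_n$, if the vectors $\mathbf{v}_1-\mathbf{v}_0,\dots,\mathbf{v}_n-\mathbf{v}_0$ are linearly independent. Every $\mathbf{x}\in T$ is uniquely of the form $\mathbf{x}=\xi_0\mathbf{v}_0+\dots+\xi_n\mathbf{v}_n$ with $\xi_j\ge 0$ and $\sum_j\xi_j=1$; the numbers $(\xi_0,\dots,\xi_n)$ are the barycentric coordinates of $\mathbf{x}$. A permutation $\sigma$ of $\{0,\dots,n\}$ generates an affine mapping, also denoted $\sigma:T\to T$, given in barycentric coordinates by $\sigma(\xi_0,\dots,\xi_n)=(\xi_{\sigma(0)},\dots,\xi_{\sigma(n)})$. Put $$\mathcal{L}(f,T;g)=\int_T f(\mathbf{x})g(\mathbf{x})\,d\mathbf{x}-f\left(\frac{1}{n+1}\sum_{i=0}^n\mathbf{v}_i\right)\int_T g(\mathbf{x})\,d\mathbf{x},$$ $$\mathcal{R}(f,T;g)=\left(\frac{1}{n+1}\sum_{i=0}^n f(\mathbf{v}_i)\right)\int_T g(\mathbf{x})\,d\mathbf{x}-\int_T f(\mathbf{x})g(\mathbf{x})\,d\mathbf{x},$$ $$\Delta(f,T)=\frac{1}{n+1}\sum_{i=0}^n f(\mathbf{v}_i)-f\left(\frac{1}{n+1}\sum_{i=0}^n\mathbf{v}_i\right).$$ *)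

(* Defs.v *)
From HB Require Import structures.
From mathcomp Require Import all_boot all_order all_algebra all_fingroup.
From mathcomp Require Import all_classical all_reals all_analysis.

Set Implicit Arguments.
Unset Strict Implicit.
Unset Printing Implicit Defensive.

Import Order.TTheory GRing.Theory Num.Theory.
Import numFieldNormedType.Exports.

Local Open Scope classical_set_scope.
Local Open Scope ring_scope.

Definition rV_display : measure_display. Proof. exact: default_measure_display. Qed.

(* Borel sigma-algebra of R^n, generated by the coordinate projections. *)
Section measurable_rV.
Context {R : realType} {n : nat}.

Definition rV_coord (i : 'I_n) (x : 'rV[R]_n) : R := x 0 i.

Let rV_set0 : g_sigma_preimage rV_coord set0.
Proof. exact: sigma_algebra0. Qed.

Let rV_setC A : g_sigma_preimage rV_coord A -> g_sigma_preimage rV_coord (~` A).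
Proof. exact: sigma_algebraC. Qed.

Let rV_bigcup (F : _^nat) : (forall i, g_sigma_preimage rV_coord (F i)) ->
  g_sigma_preimage rV_coord (\bigcup_i (F i)).
Proof. exact: sigma_algebra_bigcup. Qed.

HB.instance Definition _ := @isMeasurable.Build rV_display
  'rV[R]_n (g_sigma_preimage rV_coord) rV_set0 rV_setC rV_bigcup.

End measurable_rV.

Lemma measurable_rV_coord (R : realType) (n : nat) (i : 'I_n) :
  measurable_fun [set: 'rV[R]_n] (rV_coord i).
Proof.
move=> _ Y mY; rewrite setTI; apply: sub_sigma_algebra => /=.
rewrite -bigcup_seq/=; exists i => /=; first by rewrite mem_index_enum.
by exists Y => //; rewrite setTI.
Qed.

Lemma measurable_fun_rV (R : realType) (n : nat) d (T : measurableType d)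
    (f : T -> 'rV[R]_n) :
  (forall i, measurable_fun [set: T] (fun t => f t 0 i)) ->
  measurable_fun [set: T] f.
Proof.
move=> mf; apply: (@measurability _ _ _ _ setT f
  (\big[setU/set0]_(i < n) preimage_set_system setT (rV_coord i) measurable)).
  by [].
move=> _ [A + <-]; rewrite -bigcup_seq => -[i _ [B mB <-]].
by rewrite setTI; exact: (mf i).
Qed.

Section lebesgue_rV.
Context (R : realType).

Definition rV_cons (n : nat) (p : R * 'rV[R]_n) : 'rV[R]_n.+1 :=
  row_mx p.1%:M p.2 : 'rV[R]_(1 + n).

Lemma rV_consE0 n (t : R) (x : 'rV[R]_n) : rV_cons (t, x) 0 ord0 = t.
Proof.
transitivity ((row_mx t%:M x : 'rV[R]_(1 + n)) 0 (lshift n ord0)).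
  by congr (fun_of_matrix _ _ _); exact: val_inj.
by rewrite row_mxEl mxE eqxx mulr1n.
Qed.

Lemma rV_consES n (t : R) (x : 'rV[R]_n) i :
  rV_cons (t, x) 0 (lift ord0 i) = x 0 i.
Proof.
transitivity ((row_mx t%:M x : 'rV[R]_(1 + n)) 0 (rshift 1 i)).
  by congr (fun_of_matrix _ _ _); exact: val_inj.
by rewrite row_mxEr.
Qed.

Lemma measurable_rV_cons n : measurable_fun [set: R * 'rV[R]_n] (@rV_cons n).
Proof.
apply: measurable_fun_rV => i; case: (unliftP ord0 i) => [j ->|->].
- rewrite (_ : (fun t => _) = rV_coord j \o snd).
    by apply: measurableT_comp; [exact: measurable_rV_coord|exact: measurable_snd].
  by apply/funext => -[t x]; exact: rV_consES.
- rewrite (_ : (fun t => _) = fst); first exact: measurable_fst.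
  by apply/funext => -[t x]; exact: rV_consE0.
Qed.

Section rV_product.
Context (n : nat) (mu : {measure set 'rV[R]_n -> \bar R}).

Definition rV_product : set 'rV[R]_n.+1 -> \bar R :=
  pushforward (lebesgue_measure \x^ mu)%E (@rV_cons n).

Let mcons := @measurable_rV_cons n.

Let rV_product0 : rV_product set0 = 0%E.
Proof. by rewrite /rV_product /pushforward preimage_set0 measure0. Qed.

Let rV_product_ge0 A : (0 <= rV_product A)%E.
Proof. exact: measure_ge0. Qed.

Let rV_product_sigma_additive : semi_sigma_additive rV_product.
Proof.
move=> F mF tF mUF; rewrite /rV_product /pushforward preimage_bigcup.
apply: measure_semi_sigma_additive.
- by move=> k; rewrite -[X in measurable X]setTI; exact: mcons.
- apply/trivIsetP => /= i j _ _ ij; rewrite -preimage_setI.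
  by move/trivIsetP : tF => /(_ _ _ _ _ ij) ->//; rewrite preimage_set0.
- by rewrite -preimage_bigcup -[X in measurable X]setTI; exact: mcons.
Qed.

HB.instance Definition _ := isMeasure.Build _ _ _ rV_product
  rV_product0 rV_product_ge0 rV_product_sigma_additive.

End rV_product.

(* n-fold product of the one-dimensional Lebesgue measure, on Borel sets; the
   values on boxes are given by borel_lebesgue_rV_box below. *)
Fixpoint borel_lebesgue_rV (n : nat) : {measure set 'rV[R]_n -> \bar R} :=
  match n with
  | 0 => \d_(0 : 'rV[R]_0)
  | m.+1 => rV_product (borel_lebesgue_rV m)
  end.

Lemma measurable_rV_box (n : nat) (A : 'I_n -> set R) :
  (forall i, measurable (A i)) ->
  measurable [set x : 'rV[R]_n | forall i, A i (x 0 i)].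
Proof.
move=> mA; rewrite (_ : mkset _ = \bigcap_(i in setT) (rV_coord i @^-1` A i)).
  apply: fin_bigcap_measurable => // i _.
  by rewrite -[X in measurable X]setTI; exact: measurable_rV_coord.
by apply/seteqP; split => x /= Ax i; [move=> _|]; exact: (Ax i).
Qed.

Lemma borel_lebesgue_rV_box (n : nat) (A : 'I_n -> set R) :
  (forall i, measurable (A i)) ->
  borel_lebesgue_rV n [set x | forall i, A i (x 0 i)] =
  (\prod_(i < n) lebesgue_measure (A i))%E.
Proof.
elim: n A => [|n IHn] A mA.
  rewrite big_ord0 [LHS]diracE mem_set//=.
  by case.
rewrite big_ord_recl -IHn// -product_measure2E; first last.
- by apply: (@measurable_rV_box n (fun i => A (lift ord0 i))) => i; exact: mA.
- exact: mA.
congr ((_ \x^ _)%E _); apply/seteqP; split => -[t x] /=.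
- move=> Atx; split=> [|i].
    by rewrite -(rV_consE0 t x); exact: (Atx ord0).
  by rewrite -(rV_consES t x i); exact: (Atx (lift ord0 i)).
- move=> [At Ax] i; case: (unliftP ord0 i) => [j ->|->].
    by rewrite rV_consES; exact: (Ax j).
  by rewrite rV_consE0.
Qed.

(* Completion of the Borel measure: its domain type caratheodory_type carries
   the Lebesgue sigma-algebra, so that measurability and integrability with
   respect to lebesgue_rV are those of Lebesgue. *)
Definition lebesgue_rV (n : nat) :=
  @completed_measure_extension _ _ _ (borel_lebesgue_rV n).
Arguments lebesgue_rV : clear implicits.

HB.instance Definition _ n := Measure.on (lebesgue_rV n).

Lemma lebesgue_rV_borel (n : nat) (A : set 'rV[R]_n) :
  measurable A -> lebesgue_rV n A = borel_lebesgue_rV n A.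
Proof. exact: measurable_mu_extE. Qed.

End lebesgue_rV.
Arguments lebesgue_rV {R} n _.

Section simplex.
Context {R : realType} {n : nat}.
Implicit Types (v : 'I_n.+1 -> 'rV[R]_n) (x : 'rV[R]_n).
Implicit Types (f g h : 'rV[R]_n -> R) (xi : 'I_n.+1 -> R).

Definition simplex_vertices v : bool :=
  free [tuple v (lift ord0 i) - v ord0 | i < n].

Definition is_barycentric v x xi : Prop :=
  [/\ forall j, 0 <= xi j, \sum_j xi j = 1 & x = \sum_j xi j *: v j].

(* convex hull of the vertices *)
Definition simplex v : set 'rV[R]_n := [set x | exists xi, is_barycentric v x xi].

(* The barycentric coordinates of x; only meaningful for x in simplex v, where
   baryP characterizes them. *)
Definition bary v x : 'I_n.+1 -> R := get (is_barycentric v x).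

Lemma is_barycentric_inj v x xi xi' : simplex_vertices v ->
  is_barycentric v x xi -> is_barycentric v x xi' -> xi = xi'.
Proof.
move=> /freeP fv [_ s1 xE] [_ s1' xE'].
pose d j := xi j - xi' j.
have d0 : d ord0 + \sum_(i < n) d (lift ord0 i) = 0.
  by rewrite -(big_ord_recl _ d) sumrB s1 s1' subrr.
have dv : d ord0 *: v ord0 + \sum_(i < n) d (lift ord0 i) *: v (lift ord0 i) = 0.
  rewrite -(big_ord_recl _ (fun j => d j *: v j)).
  under eq_bigr do rewrite scalerBl.
  by rewrite sumrB -xE -xE' subrr.
have dl i : d (lift ord0 i) = 0.
  apply: (fv (fun i => d (lift ord0 i))).
  under eq_bigr do rewrite nth_mktuple scalerBr.
  rewrite sumrB -scaler_suml; apply/eqP; rewrite subr_eq0; apply/eqP.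
  by move/eqP: d0; rewrite addrC addr_eq0 => /eqP->; move/eqP: dv;
    rewrite addrC addr_eq0 -scaleNr => /eqP.
apply/funext => j; apply/eqP; rewrite -subr_eq0 -/(d j); apply/eqP.
case: (unliftP ord0 j) => [i ->//|->].
by move: d0; rewrite big1 ?addr0.
Qed.

Lemma baryP v x xi : simplex_vertices v ->
  is_barycentric v x xi -> bary v x = xi.
Proof.
move=> sv bx; apply: (is_barycentric_inj sv _ bx).
exact: (getI bx).
Qed.

Definition min_bary v x : R := \big[Num.min/bary v x ord0]_j bary v x j.

(* the affine self-map of the simplex generated by the permutation s *)
Definition simplex_perm v (s : 'S_n.+1) x : 'rV[R]_n :=
  \sum_j bary v x (s j) *: v j.

(* s consists of a single cycle, of length n + 1 *)
Definition full_cycle (s : 'S_n.+1) : bool := porbits s == [set [set: 'I_n.+1]]%SET.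

Definition simplex_integral v h : R := \int[lebesgue_rV n]_(x in simplex v) h x.

Definition barycenter v : 'rV[R]_n := n.+1%:R^-1 *: \sum_i v i.

Definition vertex_mean f v : R := n.+1%:R^-1 * \sum_i f (v i).

Definition HH_left f v g : R :=
  simplex_integral v (fun x => f x * g x) -
  f (barycenter v) * simplex_integral v g.

Definition HH_right f v g : R :=
  vertex_mean f v * simplex_integral v g -
  simplex_integral v (fun x => f x * g x).

Definition HH_gap f v : R := vertex_mean f v - f (barycenter v).

End simplex.

(* Main.v *)
Require Import Defs.
From HB Require Import structures.
From mathcomp Require Import all_boot all_order all_algebra all_fingroup.
From mathcomp Require Import all_classical all_reals all_analysis.
From mathcomp Require Import ring lra measurable_realfun.

(** The integral of f g does not change when f is replaced by its average over
    the images of a point under the powers of the cycle: each power acts on the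
    simplex by a map which preserves Lebesgue measure and g. Two pointwise
    estimates of this average, multiplied by g and integrated, give the theorem.

    - The images of x average to the barycenter, so by Jensen's inequality the
      average of f is at least the value of f at the barycenter
      ([le_cyclic_average]).
    - If m is the least barycentric coordinate of x, each image of x is a convex
      combination of the barycenter, with weight (n + 1) m, and of the vertices.
      Averaging the resulting upper bounds for f gives at most the mean over the
      vertices minus (n + 1) m times the gap ([cyclic_average_le]).

    The upper bound yields the inequality for the right difference and, after
    subtraction of the term at the barycenter, the second inequality for the
    left one.

    Two facts of analysis support this. First, the affine map of a permutation
    preserves Lebesgue measure ([borel_lebesgue_aff_perm]). It carries
    translations to translations, so the argument for the uniqueness of Haar
    measure ([haar_preimage]) shows that it scales the measure by a constant;
    as the map has finite order, the constant is 1. The completed measure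
    inherits this because the outer measure does. Secondly, f g has to be
    integrable: a convex function on a simplex is bounded ([convex_bounded]) and
    upper semicontinuous up to the boundary ([convex_usc]), hence bounded and
    Borel measurable ([measurable_fun_convex]). *)

Set Implicit Arguments.
Unset Strict Implicit.
Unset Printing Implicit Defensive.

Import Order.TTheory GRing.Theory Num.Theory.
Import numFieldNormedType.Exports.

Local Open Scope classical_set_scope.
Local Open Scope ring_scope.

(** * Barycentric coordinates as affine functions *)

Section affine_coordinates.
Context {R : realType} {n : nat} (v : 'I_n.+1 -> 'rV[R]_n).
Implicit Types (x y w : 'rV[R]_n) (xi : 'I_n.+1 -> R) (s t : 'S_n.+1).

Definition edge_mx : 'M[R]_n := \matrix_i (v (lift ord0 i) - v ord0).

Definition edge_coord x : 'rV[R]_n := (x - v ord0) *m invmx edge_mx.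

(** The barycentric coordinates as affine functions on the whole space, where
    they may be negative. Being total, they avoid the choice operator behind
    [bary], which makes measurability and composition of the permutation maps
    immediate; they agree with [bary] on the simplex. *)
Definition aff_bary x (j : 'I_n.+1) : R :=
  if unlift ord0 j is Some i then edge_coord x 0 i
  else 1 - \sum_i edge_coord x 0 i.

Definition aff_perm s x : 'rV[R]_n := \sum_j aff_bary x (s j) *: v j.

Lemma aff_bary0 x : aff_bary x ord0 = 1 - \sum_i edge_coord x 0 i.
Proof. by rewrite /aff_bary unlift_none. Qed.

Lemma aff_baryS x i : aff_bary x (lift ord0 i) = edge_coord x 0 i.
Proof. by rewrite /aff_bary liftK. Qed.

Lemma sum_aff_bary x : \sum_j aff_bary x j = 1.
Proof.
rewrite big_ord_recl aff_bary0.
by under [X in _ + X]eq_bigr do rewrite aff_baryS; rewrite subrK.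
Qed.

Lemma affine_sumE xi : \sum_j xi j = 1 ->
  \sum_j xi j *: v j = v ord0 + (\row_i xi (lift ord0 i)) *m edge_mx.
Proof.
move=> s1; rewrite mulmx_sum_row [LHS]big_ord_recl.
under [X in _ = _ + X]eq_bigr do rewrite rowK mxE scalerBr.
rewrite sumrB -scaler_suml addrCA [LHS]addrC; congr (_ + _).
by rewrite -[X in _ = X - _]scale1r -scalerBl -s1 big_ord_recl addrK.
Qed.

(** Affinity, in a form that needs neither subtraction nor a linear part. *)
Lemma aff_baryD x w j :
  aff_bary (x + w) j + aff_bary 0 j = aff_bary x j + aff_bary w j.
Proof.
have cD : edge_coord (x + w) + edge_coord 0 = edge_coord x + edge_coord w.
  by rewrite /edge_coord -!mulmxDl; congr (_ *m _); rewrite sub0r addrACA addrA.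
have cDi i : edge_coord (x + w) 0 i + edge_coord 0 0 i =
    edge_coord x 0 i + edge_coord w 0 i.
  by move/rowP : cD => /(_ i); rewrite !mxE.
case: (unliftP ord0 j) => [i ->|->]; first by rewrite !aff_baryS.
rewrite !aff_bary0 [LHS]addrACA [RHS]addrACA -!opprD -!big_split/=.
by congr (_ - _); exact: eq_bigr.
Qed.

Lemma measurable_aff_bary j : measurable_fun [set: 'rV[R]_n] (aff_bary ^~ j).
Proof.
have mc i : measurable_fun [set: 'rV[R]_n] (fun x => edge_coord x 0 i).
  rewrite /edge_coord; under eq_fun do rewrite mxE.
  apply: (@measurable_sum _ _ _ _ _ _ (fun k x => (x - v ord0) 0 k * _)) => k.
  apply: measurable_funM => //; under eq_fun do rewrite mxE.
  by apply: measurable_funD => //; exact: measurable_rV_coord.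
case: (unliftP ord0 j) => [i ->|->].
  by under eq_fun do rewrite aff_baryS; exact: mc.
under eq_fun do rewrite aff_bary0.
apply: measurable_funB => //.
exact: (@measurable_sum _ _ _ _ _ _ (fun k x => edge_coord x 0 k)).
Qed.

Lemma measurable_aff_perm s : measurable_fun [set: 'rV[R]_n] (aff_perm s).
Proof.
apply: measurable_fun_rV => i; rewrite /aff_perm.
under eq_fun do rewrite summxE.
apply: (@measurable_sum _ _ _ _ _ _
  (fun k x => (aff_bary x (s k) *: v k) 0 i)) => k.
under eq_fun do rewrite mxE.
by apply: measurable_funM => //; exact: measurable_aff_bary.
Qed.

Lemma aff_permD s x w : aff_perm s (x + w) + aff_perm s 0 =
  aff_perm s x + aff_perm s w.
Proof.
rewrite /aff_perm -!big_split/=; apply: eq_bigr => j _.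
by rewrite -!scalerDl aff_baryD.
Qed.

Hypothesis simplex_v : simplex_vertices v.

Lemma edge_mx_unit : edge_mx \in unitmx.
Proof.
rewrite -row_free_unit; apply: inj_row_free => u u0.
apply/rowP => i; rewrite [RHS]mxE; move/freeP : simplex_v; apply.
rewrite -[RHS]u0 mulmx_sum_row; apply: eq_bigr => k _.
by rewrite rowK nth_mktuple.
Qed.

Lemma aff_bary_uniq x xi : \sum_j xi j = 1 -> x = \sum_j xi j *: v j ->
  aff_bary x = xi.
Proof.
move=> s1 xE.
have cE : edge_coord x = \row_i xi (lift ord0 i).
  by rewrite /edge_coord xE affine_sumE// addrC addKr mulmxK// edge_mx_unit.
apply/funext => j; case: (unliftP ord0 j) => [i ->|->].
  by rewrite aff_baryS cE mxE.
rewrite aff_bary0 cE -s1 big_ord_recl.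
by under [X in _ - X]eq_bigr do rewrite mxE; rewrite addrK.
Qed.

Lemma aff_baryK x : \sum_j aff_bary x j *: v j = x.
Proof.
rewrite affine_sumE ?sum_aff_bary//.
have -> : \row_i aff_bary x (lift ord0 i) = edge_coord x.
  by apply/rowP => i; rewrite mxE aff_baryS.
by rewrite /edge_coord mulmxKV ?edge_mx_unit// addrC subrK.
Qed.

Lemma simplexP x : simplex v x <-> forall j, 0 <= aff_bary x j.
Proof.
split=> [[xi [xi0 s1 xE]] j|x0]; first by rewrite (aff_bary_uniq s1 xE).
by exists (aff_bary x); split; rewrite ?sum_aff_bary ?aff_baryK.
Qed.

Lemma baryE x : simplex v x -> bary v x = aff_bary x.
Proof.
move=> /simplexP x0; apply: baryP => //.
by split; rewrite ?sum_aff_bary ?aff_baryK.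
Qed.

Lemma simplex_permE s x : simplex v x -> simplex_perm v s x = aff_perm s x.
Proof. by move=> Tx; rewrite /simplex_perm baryE. Qed.

Lemma aff_bary_perm s x j : aff_bary (aff_perm s x) j = aff_bary x (s j).
Proof.
have s1 : \sum_j aff_bary x (s j) = 1.
  by rewrite -(sum_aff_bary x) [RHS](reindex_inj (@perm_inj _ s)).
by rewrite (aff_bary_uniq s1 erefl).
Qed.

(** The permutations act on the whole space by affine bijections; in
    particular the map of a permutation of order N has N-th iterate the
    identity. *)
Lemma aff_permM s t x : aff_perm (s * t)%g x = aff_perm s (aff_perm t x).
Proof. by apply: eq_bigr => j _; rewrite aff_bary_perm permM. Qed.

Lemma aff_perm1 x : aff_perm 1%g x = x.
Proof.
by rewrite -[RHS]aff_baryK; apply: eq_bigr => j _; rewrite perm1.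
Qed.

Lemma simplex_aff_perm s : aff_perm s @^-1` simplex v = simplex v.
Proof.
apply/seteqP; split => x /= /simplexP x0; apply/simplexP => j.
  by rewrite -(permKV s j) -aff_bary_perm.
by rewrite aff_bary_perm.
Qed.

Lemma measurable_simplex : measurable (simplex v).
Proof.
rewrite (_ : simplex v = \bigcap_(j in setT) (aff_bary ^~ j @^-1` `[0, +oo[)).
  apply: fin_bigcap_measurable => // j _.
  by rewrite -[X in measurable X]setTI; exact: measurable_aff_bary.
apply/seteqP; split => x /=.
  by move/simplexP => x0 j _ /=; rewrite in_itv/= andbT.
by move=> x0; apply/simplexP => j; have /= := x0 j I; rewrite in_itv/= andbT.
Qed.

End affine_coordinates.

(** * Translation invariance of Lebesgue measure *)

Section translation_invariance.
Context {R : realType}.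

Lemma lebesgue_measure_translation (a : R) (A : set R) : measurable A ->
  lebesgue_measure ((+%R a) @^-1` A) = lebesgue_measure A.
Proof.
move=> mA; rewrite -[LHS]/(pushforward lebesgue_measure
  (+%R a : measurableTypeR R -> measurableTypeR R) A).
apply/esym/lebesgue_measure_unique => //= [|_ _ [[b c] _ <-]].
  exact: (@measurable_funD _ _ R).
rewrite /pushforward (_ : _ @^-1` _ = `]b - a, c - a]%classic); last first.
  by apply/seteqP; split => x /=; rewrite !in_itv/= ltrBlDl lerBrDl.
by rewrite !lebesgue_measure_itv/= !lte_fin ltrD2r -!EFinD opprB addrA subrK.
Qed.

Definition rV_box n (B : 'I_n -> set R) : set 'rV[R]_n :=
  [set x | forall i, B i (x 0 i)].

Definition rV_cube n (k : nat) : set 'rV[R]_n :=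
  rV_box (fun _ : 'I_n => `]- k%:R, k%:R]%classic).

Arguments rV_cube : clear implicits.

Lemma bigcup_rV_cube n : \bigcup_k rV_cube n k = setT.
Proof.
rewrite -subTset => x _.
pose M := \big[Num.max/0]_(i < n) `|x 0 i|.
exists (Num.truncn M).+1 => // i /=; rewrite in_itv/=.
have : `|x 0 i| < (Num.truncn M).+1%:R.
  apply: le_lt_trans (truncnS_gt _).
  exact: (@le_bigmax _ _ _ _ (fun i => `|x 0 i|)).
by rewrite ltr_norml => /andP[-> /ltW].
Qed.

Lemma measurable_rV_cube n k : measurable (rV_cube n k).
Proof. exact: measurable_rV_box. Qed.

Lemma borel_lebesgue_rV_cube_lty n k :
  (borel_lebesgue_rV R n (rV_cube n k) < +oo)%E.
Proof.
rewrite borel_lebesgue_rV_box// -ge0_fin_numE; last first.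
  by apply: prode_ge0 => i _; exact: measure_ge0.
apply: prode_fin_num => i _.
by rewrite lebesgue_measure_itv/=; case: ifP.
Qed.

Lemma borel_lebesgue_rV_unit_cube n :
  borel_lebesgue_rV R n (rV_box (fun=> `]0, 1]%classic)) = 1%E.
Proof.
rewrite borel_lebesgue_rV_box// big1// => i _.
by rewrite lebesgue_measure_itv/= lte_fin ltr01 oppr0 adde0.
Qed.

Lemma borel_lebesgue_rV_sigma_finite n :
  sigma_finite [set: 'rV[R]_n] (borel_lebesgue_rV R n).
Proof.
exists (rV_cube n); first by rewrite bigcup_rV_cube.
move=> k; split; first exact: measurable_rV_cube.
exact: borel_lebesgue_rV_cube_lty.
Qed.

(** As boxes are stable under intersection, measures that are finite on cubes
    and agree on boxes are then equal. *)
Lemma measurable_rV_boxE n : @measurable _ 'rV[R]_n =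
  <<s @rV_box n @` [set B | forall i, measurable (B i)] >>.
Proof.
apply/seteqP; split; last first.
  apply: smallest_sub; first exact: sigma_algebra_measurable.
  by move=> _ [B mB <-]; exact: measurable_rV_box.
apply: smallest_sub; first exact: smallest_sigma_algebra.
move=> A /=; rewrite -bigcup_seq => -[i _ [B mB <-]].
apply: sub_sigma_algebra; exists (fun k => if k == i then B else setT).
  by move=> k; case: ifP.
rewrite setTI; apply/seteqP; split => x /=.
  by move=> /(_ i); rewrite eqxx.
by move=> Bx k; case: eqP => [->|].
Qed.

(** On a box the measure is a product of lengths, and each side is translated
    separately. *)
Lemma borel_lebesgue_rV_translation n (a : 'rV[R]_n) (A : set 'rV[R]_n) :
  measurable A ->
  borel_lebesgue_rV R n ((+%R a) @^-1` A) = borel_lebesgue_rV R n A.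
Proof.
move=> mA; rewrite -[LHS]/(pushforward (borel_lebesgue_rV R n) (+%R a) A).
apply/esym.
apply: (measure_unique _ _ (measurable_rV_boxE n) _ _
  (bigcup_rV_cube n)) => //=.
- move=> _ _ [B mB <-] [C mC <-]; exists (fun i => B i `&` C i).
    by move=> i; exact: measurableI.
  apply/seteqP; split => x /= => [BCx|[Bx Cx] i]; last by split.
  by split => i; have [] := BCx i.
- by move=> k; exists (fun=> `]- k%:R, k%:R]%classic).
- apply: measurable_fun_rV => i; under eq_fun do rewrite mxE.
  by apply: measurable_funD => //; exact: measurable_rV_coord.
- move=> _ _ [B mB <-]; rewrite /pushforward.
  have -> : +%R a @^-1` rV_box B = rV_box (fun i => +%R (a 0 i) @^-1` B i).
    by apply/seteqP; split => x /= Bx i; have := Bx i; rewrite /= mxE.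
  rewrite !borel_lebesgue_rV_box//.
    by apply: eq_bigr => i _; rewrite lebesgue_measure_translation.
  move=> i; rewrite -[X in measurable X]setTI.
  exact: (@measurable_funD _ _ R _ (cst (a 0 i)) id).
- exact: borel_lebesgue_rV_cube_lty.
Qed.

End translation_invariance.

(** A copy of the measure under a rigid name, to which the sigma-finiteness
    that Fubini's theorem asks for can be attached. *)
Definition sigma_borel_lebesgue_rV (R : realType) (n : nat) :
  set 'rV[R]_n -> \bar R := borel_lebesgue_rV R n.

HB.instance Definition _ (R : realType) (n : nat) :=
  Measure.on (@sigma_borel_lebesgue_rV R n).

HB.instance Definition _ (R : realType) (n : nat) :=
  @Measure_isSigmaFinite.Build _ _ _ (@sigma_borel_lebesgue_rV R n)
    (@borel_lebesgue_rV_sigma_finite R n).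

(** * Preimages under maps that carry translations to translations *)

Section haar.
Local Open Scope ereal_scope.
Context {R : realType} {n : nat}.
Variable mu : {sigma_finite_measure set 'rV[R]_n -> \bar R}.
Hypothesis mu_translation : forall (a : 'rV[R]_n) (A : set 'rV[R]_n),
  measurable A -> mu (+%R a @^-1` A) = mu A.

Lemma measurable_funD_rV d (T : measurableType d) (h k : T -> 'rV[R]_n) :
  measurable_fun setT h -> measurable_fun setT k ->
  measurable_fun setT (fun z => h z + k z)%R.
Proof.
move=> mh mk; apply: measurable_fun_rV => i; under eq_fun do rewrite mxE.
by apply: measurable_funD;
  [exact: measurableT_comp (measurable_rV_coord i) mh|
   exact: measurableT_comp (measurable_rV_coord i) mk].
Qed.

Lemma measurable_funN_rV d (T : measurableType d) (h : T -> 'rV[R]_n) :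
  measurable_fun setT h -> measurable_fun setT (fun z => - h z)%R.
Proof.
move=> mh; apply: measurable_fun_rV => i; under eq_fun do rewrite mxE.
by apply: measurable_funN; exact: measurableT_comp (measurable_rV_coord i) mh.
Qed.

(** The argument behind the uniqueness of Haar measure. The map [phi] turns
    translations into translations, so both sides are the measure of a subset
    of the product space: the pairs (x, y) with y + phi x in A and y in B on
    the left, and those with y in A and y - phi x in B on the right. For fixed x
    the two slices are translates of each other. For B of measure 1, this says
    that taking preimages under [phi] scales [mu] by a constant, without any
    mention of determinants. *)
Lemma haar_preimage (phi : 'rV[R]_n -> 'rV[R]_n) (A B : set 'rV[R]_n) :
  measurable_fun [set: 'rV[R]_n] phi ->
  (forall y, exists w, forall x, phi (w + x) = y + phi x)%R ->
  measurable A -> measurable B ->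
  mu (phi @^-1` A) * mu B = mu A * mu [set x | B (- phi x)%R].
Proof.
move=> mphi phiD mA mB.
have pre (h : 'rV[R]_n -> 'rV[R]_n) (C : set 'rV[R]_n) :
    measurable_fun setT h -> measurable C -> measurable (h @^-1` C).
  by move=> mh mC; rewrite -[X in measurable X]setTI; exact: mh.
have pre2 (h : 'rV[R]_n * 'rV[R]_n -> 'rV[R]_n) (C : set 'rV[R]_n) :
    measurable_fun setT h -> measurable C -> measurable (h @^-1` C).
  by move=> mh mC; rewrite -[X in measurable X]setTI; exact: mh.
have mu12 (X : set (_ * _)) : measurable X -> (mu \x mu) X = (mu \x^ mu) X.
  by apply: product_measure_unique => ? ? ? ? /=; rewrite product_measure2E.
(* The slices at fixed y: translating x by w translates psi x by y. *)
have muphi (C : set 'rV[R]_n) (psi : 'rV[R]_n -> 'rV[R]_n) y : measurable C ->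
    measurable_fun setT psi ->
    (exists w, forall x, psi (w + x) = y + psi x)%R ->
    mu [set x | C (y + psi x)%R] = mu (psi @^-1` C).
  move=> mC mpsi [w psiw]; rewrite -(mu_translation w (pre _ _ mpsi mC)).
  by congr (mu _); apply/seteqP; split => x /=; rewrite psiw.
pose E := [set z : 'rV[R]_n * 'rV[R]_n | A (z.2 + phi z.1)%R /\ B z.2].
pose F := [set z : 'rV[R]_n * 'rV[R]_n | A z.2 /\ B (z.2 + - phi z.1)%R].
have mphi1 : measurable_fun [set: 'rV[R]_n * 'rV[R]_n] (phi \o fst).
  exact: measurableT_comp.
have mE : measurable E.
  apply: (@measurableI _ _ ((fun z => z.2 + phi z.1)%R @^-1` A) (snd @^-1` B)).
    by apply: pre2 => //; exact: measurable_funD_rV.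
  exact: pre2.
have mF : measurable F.
  apply: (@measurableI _ _ (snd @^-1` A)
    ((fun z => z.2 + - phi z.1)%R @^-1` B)).
    exact: pre2.
  apply: pre2 => //; apply: measurable_funD_rV => //.
  exact: measurable_funN_rV.
have sliceE : (mu \x^ mu) E = mu (phi @^-1` A) * mu B.
  rewrite /product_measure2.
  rewrite (eq_integral (fun y => mu (phi @^-1` A) * (\1_B y)%:E)); last first.
    move=> y _ /=; rewrite indicE; have [yB|yB] := boolP (y \in B).
      rewrite mule1 -(muphi _ _ y)//; congr (mu _); apply/seteqP.
      rewrite inE in yB.
      by split => x; rewrite /ysection/= inE/= => // -[].
    rewrite mule0 (_ : ysection _ _ = set0) ?measure0//.
    rewrite -subset0 => x; rewrite /ysection/= inE/= => -[_ By].
    by move: yB; rewrite notin_setE.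
  by rewrite ge0_integralZl ?integral_indic ?setIT//; exact: measurableT_comp.
have sliceF : (mu \x^ mu) F = mu A * mu [set x | B (- phi x)%R].
  rewrite /product_measure2.
  rewrite (eq_integral
    (fun y => mu [set x | B (- phi x)%R] * (\1_A y)%:E)); last first.
    move=> y _ /=; rewrite indicE; have [yA|yA] := boolP (y \in A).
      rewrite mule1 -(muphi _ (fun x => - phi x)%R y)//; first last.
      - have [w wE] := phiD (- y)%R; exists w => x.
        by rewrite wE opprD opprK.
      - exact: measurable_funN_rV.
      congr (mu _); apply/seteqP; rewrite inE in yA.
      by split => x; rewrite /ysection/= inE/= => // -[].
    rewrite mule0 (_ : ysection _ _ = set0) ?measure0//.
    rewrite -subset0 => x; rewrite /ysection/= inE/= => -[Ay _].
    by move: yA; rewrite notin_setE.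
  rewrite ge0_integralZl ?integral_indic ?setIT//; last exact: measurableT_comp.
  by rewrite muleC.
(* Slicing at fixed x instead, the two sets differ by a translation of y. *)
rewrite -sliceE -sliceF -!mu12//; apply: eq_integral => x _ /=.
rewrite -(mu_translation (- phi x)%R); last exact: measurable_xsection.
congr (mu _); apply/seteqP.
have yE y : (- phi x + y + phi x = y)%R by rewrite addrAC addNr add0r.
by split => y; rewrite /xsection/= !inE /E /F/= yE (addrC y) => -[].
Qed.

End haar.

(** * Invariance under the affine maps of permutations *)

Section aff_perm_measure.
Context {R : realType} {n : nat} (v : 'I_n.+1 -> 'rV[R]_n).
Hypothesis simplex_v : simplex_vertices v.
Implicit Types (A : set 'rV[R]_n) (s t : 'S_n.+1).
Local Notation mu := (borel_lebesgue_rV R n).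

Lemma aff_perm_cover s y :
  exists w, forall x, aff_perm v s (w + x) = y + aff_perm v s x.
Proof.
exists (aff_perm v s^-1%g (aff_perm v s 0 + y)) => x.
apply: (addIr (aff_perm v s 0)).
rewrite aff_permD -aff_permM// mulgV aff_perm1//.
by rewrite -addrA addrC -addrA [aff_perm v s x + _]addrC addrA.
Qed.

Lemma aff_perm_scaling s : exists2 c, (0 <= c)%E &
  forall A, measurable A -> mu (aff_perm v s @^-1` A) = (mu A * c)%E.
Proof.
pose B : set 'rV[R]_n := rV_box (fun=> `]0, 1]%classic).
have mB : measurable B by exact: measurable_rV_box.
have B1 : mu B = 1%E by exact: borel_lebesgue_rV_unit_cube.
exists (mu [set x | B (- aff_perm v s x)]) => [|A mA]; first exact: measure_ge0.
rewrite -[LHS]mule1 -B1.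
apply: (@haar_preimage _ _ (@sigma_borel_lebesgue_rV R n)) => //.
- exact: borel_lebesgue_rV_translation.
- exact: measurable_aff_perm.
- exact: aff_perm_cover.
Qed.

(** The scaling constant c of a permutation of order N satisfies c ^ N = 1,
    hence equals 1. *)
Lemma borel_lebesgue_aff_perm s A : measurable A ->
  mu (aff_perm v s @^-1` A) = mu A.
Proof.
have [c c0 muc] := aff_perm_scaling s.
have muX k C : measurable C ->
    mu (aff_perm v (s ^+ k)%g @^-1` C) = (mu C * c ^+ k)%E.
  elim: k C => [|k IH] C mC.
    rewrite expg0 mule1; congr (mu _).
    by apply/seteqP; split => x; rewrite /= aff_perm1.
  have mC' : measurable (aff_perm v s @^-1` C).
    by rewrite -[X in measurable X]setTI; exact: measurable_aff_perm.
  rewrite (_ : _ @^-1` C =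
      aff_perm v (s ^+ k)%g @^-1` (aff_perm v s @^-1` C)).
    by rewrite IH// muc// expeS muleA.
  by apply/seteqP; split => x; rewrite /= expgS aff_permM.
pose B : set 'rV[R]_n := rV_box (fun=> `]0, 1]%classic).
have mB : measurable B by exact: measurable_rV_box.
have B1 : mu B = 1%E by exact: borel_lebesgue_rV_unit_cube.
have := muX #[s]%g B mB; rewrite expg_order B1 mul1e.
have -> : aff_perm v 1%g @^-1` B = B.
  by apply/seteqP; split => x; rewrite /= aff_perm1.
rewrite B1.
have s0 := order_gt0 s.
case: c c0 muc {muX} => [c| |] //= c0 muc.
  rewrite -EFin_expe => -[/esym/eqP]; rewrite pexpr_eq1// => /eqP c1 mA.
  by rewrite muc// c1 mule1.
have -> : (+oo ^+ #[s]%g = +oo :> \bar R)%E.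
  case: #[s]%g s0 => // k _; elim: k => [//|k IH].
  by rewrite expeS IH mulyy.
by [].
Qed.

End aff_perm_measure.

Section measure_preserving.
Local Open Scope ereal_scope.
Context d (T : measurableType d) (R : realType) (m : {measure set T -> \bar R}).
Variables (phi : T -> T) (D : set T).
Hypotheses (mphi : measurable_fun [set: T] phi)
  (m_phi : forall A, measurable A -> m (phi @^-1` A) = m A)
  (mD : measurable D) (phiD : phi @^-1` D = D).

Lemma ge0_integral_preserving (f : T -> \bar R) : measurable_fun D f ->
  (forall x, 0 <= f x) -> \int[m]_(x in D) f (phi x) = \int[m]_(x in D) f x.
Proof.
move=> mf f0; rewrite -[in LHS]phiD.
rewrite -(@ge0_integral_pushforward _ _ _ _ _ _ mphi m D f)//.
by apply: eq_measure_integral => //= A mA _; exact: m_phi.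
Qed.

Lemma integral_preserving (f : T -> \bar R) : m.-integrable D f ->
  m.-integrable D (f \o phi) /\
  \int[m]_(x in D) f (phi x) = \int[m]_(x in D) f x.
Proof.
move=> /integrableP[mf foo]; split.
  apply/integrableP; split=> [_ Y mY|].
    have -> : D `&` (f \o phi) @^-1` Y = phi @^-1` (D `&` f @^-1` Y).
      by rewrite preimage_setI phiD.
    by rewrite -[X in measurable X]setTI; apply: mphi => //; exact: mf.
  rewrite (@ge0_integral_preserving (fun x => `|f x|))//.
  exact: measurableT_comp.
rewrite integralE [RHS]integralE; congr (_ - _).
- rewrite -[RHS]ge0_integral_preserving//; last exact: measurable_funepos.
  by apply: eq_integral => x _; rewrite !funeposE.
- rewrite -[RHS]ge0_integral_preserving//; last exact: measurable_funeneg.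
  by apply: eq_integral => x _; rewrite !funenegE.
Qed.

End measure_preserving.

Section completion.
Context {R : realType} {n : nat}.
Implicit Types (phi : 'rV[R]_n -> 'rV[R]_n) (A : set 'rV[R]_n).
Local Notation mu := (borel_lebesgue_rV R n).
Local Notation lebesgue_type := (caratheodory_type (mu_ext mu)).

Definition borel_preserving phi := measurable_fun [set: 'rV[R]_n] phi /\
  forall A, measurable A -> mu (phi @^-1` A) = mu A.

(** Preimages of the sets of a Borel cover of A form a Borel cover of the
    preimage of A, of the same total measure. The measure on the completion is
    the outer measure, so that A can be any set. *)
Lemma lebesgue_rV_preimage_le phi A : borel_preserving phi ->
  (lebesgue_rV n (phi @^-1` A) <= lebesgue_rV n A)%E.
Proof.
move=> [mphi muphi].
apply: le_ereal_inf_tmp => _ [B [mB AB] <-].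
apply: ereal_inf_lbound; exists (fun k => phi @^-1` B k).
  split=> [k|x Ax]; first by rewrite -[X in measurable X]setTI; exact: mphi.
  by have [k _ Bk] := AB _ Ax; exists k.
by apply: eq_eseriesr => k _; rewrite muphi.
Qed.

Variables phi psi : 'rV[R]_n -> 'rV[R]_n.
Hypotheses (phi_pres : borel_preserving phi) (psi_pres : borel_preserving psi).
Hypotheses (phiK : cancel phi psi) (psiK : cancel psi phi).

Lemma lebesgue_rV_preimage A : lebesgue_rV n (phi @^-1` A) = lebesgue_rV n A.
Proof.
apply/eqP; rewrite eq_le lebesgue_rV_preimage_le//=.
rewrite {1}(_ : A = psi @^-1` (phi @^-1` A)); last first.
  by apply/seteqP; split => x; rewrite /= psiK.
exact: lebesgue_rV_preimage_le.
Qed.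

(** Lebesgue measurability is defined by Caratheodory's splitting condition on
    the outer measure of arbitrary sets, which [phi] preserves. *)
Lemma lebesgue_measurable_preserving :
  measurable_fun [set: lebesgue_type] (phi : lebesgue_type -> lebesgue_type).
Proof.
have mE B : mu_ext mu (phi @^-1` B) = mu_ext mu B := lebesgue_rV_preimage B.
move=> _ A mA; rewrite setTI.
suff cA : (mu_ext mu).-caratheodory (phi @^-1` A) by exact: cA.
move=> X; have -> : X = phi @^-1` (psi @^-1` X).
  by apply/seteqP; split => x; rewrite /= phiK.
by rewrite preimage_setC -!preimage_setI !mE; exact: (mA (psi @^-1` X)).
Qed.

Lemma integral_lebesgue_preserving (D : set lebesgue_type)
    (h : lebesgue_type -> R) :
  measurable D -> phi @^-1` D = D ->
  (lebesgue_rV n).-integrable D (EFin \o h) ->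
  (lebesgue_rV n).-integrable D (EFin \o (h \o phi)) /\
  \int[lebesgue_rV n]_(x in D) h (phi x) = \int[lebesgue_rV n]_(x in D) h x.
Proof.
move=> mD phiD ih.
have [? /(congr1 fine)] := integral_preserving lebesgue_measurable_preserving
  (fun A _ => lebesgue_rV_preimage A) mD phiD ih.
by [].
Qed.

End completion.

(** * Convex functions on a simplex *)

Section jensen.
Context {R : realType} {E : lmodType R}.
Variables (D : set E) (f : E -> R).
Hypotheses (convexD : convex_set (D : set (convex_lmodType E)))
  (convex_f : convex_function (D : set (convex_lmodType E)) f).

Lemma convex2 (t : R) (x y : E) : 0 <= t -> t <= 1 -> D x -> D y ->
  D (t *: x + (1 - t) *: y) /\
  f (t *: x + (1 - t) *: y) <= t * f x + (1 - t) * f y.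
Proof.
move=> t0 t1 Dx Dy.
have := @convex_f (Itv01 t0 t1) x y (mem_set Dx) (mem_set Dy).
by have /set_mem := @convexD x y (Itv01 t0 t1) (mem_set Dx) (mem_set Dy).
Qed.

Lemma jensen (I : eqType) (r : seq I) (a : I -> R) (x : I -> E) :
  (forall i, 0 <= a i) -> (forall i, D (x i)) -> \sum_(i <- r) a i = 1 ->
  D (\sum_(i <- r) a i *: x i) /\
  f (\sum_(i <- r) a i *: x i) <= \sum_(i <- r) a i * f (x i).
Proof.
move=> + Dx; elim: r a => [|i r IH] a a0.
  by rewrite big_nil => /esym/eqP; rewrite oner_eq0.
rewrite !big_cons => s1; set S := \sum_(j <- r) a j.
have S0 : 0 <= S by exact: sumr_ge0.
have aiE : a i = 1 - S by rewrite -s1 addrK.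
have [Sz|Sn] := eqVneq S 0.
  have az j : j \in r -> a j = 0.
    by move=> jr; move: Sz => /eqP; rewrite psumr_eq0// => /allP /(_ _ jr) /eqP.
  rewrite (@big1_seq _ _ _ _ _ _ (fun j => a j *: x j)); last first.
    by move=> j /andP[_ /az ->]; rewrite scale0r.
  rewrite (@big1_seq _ _ _ _ _ _ (fun j => a j * f (x j))); last first.
    by move=> j /andP[_ /az ->]; rewrite mul0r.
  by rewrite aiE Sz subr0 !scale1r !mul1r !addr0.
have [||] := IH (fun j => S^-1 * a j).
  by move=> j; rewrite mulr_ge0 ?invr_ge0.
  by rewrite -mulr_sumr mulVf.
have -> : \sum_(j <- r) (S^-1 * a j) *: x j =
    S^-1 *: \sum_(j <- r) a j *: x j.
  by rewrite scaler_sumr; apply: eq_bigr => j _; rewrite scalerA.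
have -> : \sum_(j <- r) S^-1 * a j * f (x j) =
    S^-1 * \sum_(j <- r) a j * f (x j).
  by rewrite mulr_sumr; apply: eq_bigr => j _; rewrite mulrA.
set y := _ *: _ => Dy fy.
have SE : 1 - a i = S by rewrite aiE opprB addrC subrK.
have ai1 : a i <= 1 by rewrite -subr_ge0 SE.
have [] := convex2 (a0 i) ai1 (Dx i) Dy.
rewrite SE scalerA mulfV// scale1r => DS fS; split=> //.
apply: (le_trans fS); rewrite lerD2l.
by rewrite -ler_pdivlMl// lt_neqAle eq_sym Sn.
Qed.

End jensen.

Section convex_on_simplex.
Context {R : realType} {n : nat} (v : 'I_n.+1 -> 'rV[R]_n) (f : 'rV[R]_n -> R).
Hypotheses (simplex_v : simplex_vertices v)
  (convex_f : convex_function (simplex v) f).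
Implicit Types (x : 'rV[R]_n) (a : 'I_n.+1 -> R).

Lemma convex_simplex : convex_set (simplex v : set (convex_lmodType 'rV[R]_n)).
Proof.
move=> x y t; rewrite !inE => -[a [a0 a1 ->]] [b [b0 b1 ->]].
exists (fun j => t%:num * a j + (1 - t%:num) * b j); split.
- by move=> j; rewrite addr_ge0// mulr_ge0// ?subr_ge0.
- by rewrite big_split/= -!mulr_sumr a1 b1 !mulr1 addrC subrK.
- rewrite /conv/= !scaler_sumr -big_split/=.
  by apply: eq_bigr => j _; rewrite !scalerA scalerDl.
Qed.

Lemma simplex_vertex j : simplex v (v j).
Proof.
exists (fun i => (i == j)%:R); split=> [i||]; first by [].
- by rewrite (bigD1 j)//= eqxx big1 ?addr0// => i /negPf ->.
- rewrite (bigD1 j)//= eqxx scale1r big1 ?addr0// => i /negPf ->.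
  by rewrite scale0r.
Qed.

(** All uses of convexity on the simplex, apart from the average over the
    cycle, are instances of this form of Jensen's inequality, in which one
    point p is arbitrary and the others are the vertices. *)
Lemma convex_add_vertices w p a : 0 <= w -> simplex v p ->
  (forall j, 0 <= a j) -> w + \sum_j a j = 1 ->
  f (w *: p + \sum_j a j *: v j) <= w * f p + \sum_j a j * f (v j).
Proof.
move=> w0 Tp a0 wa1.
(* None indexes the point p, and Some j the vertex v j. *)
pose r := None :: [seq Some j | j <- index_enum 'I_n.+1].
pose b (i : option 'I_n.+1) := if i is Some j then a j else w.
pose q (i : option 'I_n.+1) := if i is Some j then v j else p.
have [||| _] := @jensen _ _ _ _ convex_simplex convex_f _ r b q.
- by case.
- by case=> [j|//]; exact: simplex_vertex.
- by rewrite /r big_cons big_map.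
by rewrite /r !big_cons !big_map.
Qed.

Lemma barycenterE : barycenter v = \sum_j n.+1%:R^-1 *: v j.
Proof. by rewrite /barycenter scaler_sumr. Qed.

Lemma sum_inv_card : \sum_(j < n.+1) n.+1%:R^-1 = 1 :> R.
Proof. by rewrite sumr_const card_ord -[LHS]mulr_natr mulVf ?pnatr_eq0. Qed.

Lemma simplex_barycenter : simplex v (barycenter v).
Proof.
exists (fun=> n.+1%:R^-1); split=> [j||].
- by rewrite invr_ge0.
- exact: sum_inv_card.
- exact: barycenterE.
Qed.

Lemma HH_gap_ge0 : 0 <= HH_gap f v.
Proof.
rewrite /HH_gap subr_ge0 barycenterE /vertex_mean mulr_sumr.
have k0 (j : 'I_n.+1) : 0 <= n.+1%:R^-1 :> R by rewrite invr_ge0.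
have := @convex_add_vertices 0 _ _ (lexx _) simplex_barycenter k0.
by rewrite scale0r mul0r !add0r sum_inv_card; exact.
Qed.

Lemma convex_le_vertices x : simplex v x ->
  f x <= \sum_j aff_bary v x j * f (v j).
Proof.
move=> Tx; have x0 : forall j, 0 <= aff_bary v x j by exact/simplexP.
have := @convex_add_vertices 0 _ _ (lexx _) Tx x0.
by rewrite scale0r mul0r !add0r aff_baryK// sum_aff_bary; exact.
Qed.

(** The upper bound comes from the vertices. For the lower bound, n + 1 times
    the barycenter is x plus the sum of the (1 - xi_j) v_j, with coefficients
    of total n + 1, so that convexity bounds n + 1 times the value of f at the
    barycenter by f x plus a bounded term. *)
Lemma convex_bounded : exists M, forall x, simplex v x -> `|f x| <= M.
Proof.
pose S := \sum_j `|f (v j)|; exists (S + n.+1%:R * `|f (barycenter v)|) => x Tx.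
have x0 : forall j, 0 <= aff_bary v x j by exact/simplexP.
have x1 j : aff_bary v x j <= 1.
  by rewrite -(sum_aff_bary v x) (bigD1 j)//= lerDl sumr_ge0.
have wS a : (forall j, 0 <= a j <= 1) -> \sum_j a j * f (v j) <= S.
  move=> a01; apply: ler_sum => j _; have /andP[aj0 aj1] := a01 j.
  apply: (le_trans (ler_norm _)); rewrite normrM ger0_norm//.
  by rewrite -[leRHS]mul1r ler_wpM2r.
rewrite ler_norml; apply/andP; split; last first.
  apply: (le_trans (convex_le_vertices Tx)).
  apply: (le_trans (wS _ _)) => [j|]; first by rewrite x0 x1.
  by rewrite lerDl mulr_ge0.
pose k := n.+1%:R^-1 : R.
have k0 : 0 <= k by rewrite invr_ge0.
have := @convex_add_vertices k x (fun j => k * (1 - aff_bary v x j)) k0 Tx.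
rewrite (_ : k *: x + _ = barycenter v); last first.
  under eq_bigr do rewrite -scalerA scalerBl scale1r.
  rewrite -scaler_sumr sumrB aff_baryK// -scalerDr.
  by rewrite [_ + (_ - x)]addrC subrK.
have sE : k + \sum_j k * (1 - aff_bary v x j) = 1.
  rewrite -mulr_sumr sumrB sum_aff_bary mulrBr mulr1 addrC subrK.
  by rewrite mulr_sumr; under eq_bigr do rewrite mulr1; exact: sum_inv_card.
have a0 j : 0 <= k * (1 - aff_bary v x j) by rewrite mulr_ge0// subr_ge0.
move=> /(_ a0 sE) fb.
have {}fb : n.+1%:R * f (barycenter v) <=
    f x + \sum_j (1 - aff_bary v x j) * f (v j).
  rewrite -ler_pdivlMl// -/k; apply: (le_trans fb); rewrite mulrDr mulr_sumr.
  by under eq_bigr do rewrite -mulrA.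
rewrite opprD -mulrN addrC lerBlDr.
have fS : \sum_j (1 - aff_bary v x j) * f (v j) <= S.
  by apply: wS => j; rewrite subr_ge0 x1 gerBl x0.
apply: (@le_trans _ _ (n.+1%:R * f (barycenter v))).
  by rewrite ler_wpM2l// lerNl ler_normr lexx orbT.
by rewrite (le_trans fb)// lerD2l.
Qed.

End convex_on_simplex.

(** * Measurability of convex functions *)

Section convex_measurable.
Context {R : realType} {n : nat} (v : 'I_n.+1 -> 'rV[R]_n) (f : 'rV[R]_n -> R).
Hypotheses (simplex_v : simplex_vertices v)
  (convex_f : convex_function (simplex v) f).
Implicit Types (x y : 'rV[R]_n).

(** A convex function on a simplex is upper semicontinuous, also at the
    boundary: if the coordinates of y are at least 1 - t times those of x, then
    y is (1 - t) x plus a combination of vertices of total weight t, so that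
    f y <= (1 - t) f x + t M for any upper bound M of f at the vertices. The
    condition on y is one-sided and holds automatically at the coordinates of x
    that vanish, so boundary points behave like interior ones. *)
Lemma convex_usc x c : simplex v x -> f x < c ->
  exists2 t, 0 < t <= 1 & forall y, simplex v y ->
    (forall j, (1 - t) * aff_bary v x j <= aff_bary v y j) -> f y < c.
Proof.
move=> Tx fxc; have [M fM] := convex_bounded simplex_v convex_f.
have M0 : 0 <= M by exact: le_trans (normr_ge0 _) (fM _ Tx).
pose d := c - f x; have d0 : 0 < d by rewrite subr_gt0.
pose K := M + `|f x|; have K0 : 0 <= K by rewrite addr_ge0.
have dK0 : 0 < d + K by rewrite ltr_wpDr.
(* t is chosen so that t (M - f x) <= t K < d. *)
exists (d / (d + K)) => [|y Ty xy].
  by rewrite divr_gt0//= ler_pdivrMr// mul1r lerDl.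
set t := d / (d + K) in xy *.
have t0 : 0 < t by rewrite divr_gt0.
have t1 : t <= 1 by rewrite ler_pdivrMr// mul1r lerDl.
pose a j := aff_bary v y j - (1 - t) * aff_bary v x j.
have a0 j : 0 <= a j by rewrite subr_ge0.
have sa : \sum_j a j = t.
  by rewrite sumrB -mulr_sumr !sum_aff_bary mulr1 opprB addrC subrK.
have yE : y = (1 - t) *: x + \sum_j a j *: v j.
  under eq_bigr do rewrite scalerBl -scalerA.
  by rewrite sumrB -scaler_sumr !aff_baryK// addrC subrK.
rewrite yE.
have t10 : 0 <= 1 - t by rewrite subr_ge0.
have s1 : 1 - t + \sum_j a j = 1 by rewrite sa subrK.
apply: (le_lt_trans (convex_add_vertices convex_f t10 Tx a0 s1)).
have aM : \sum_j a j * f (v j) <= t * M.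
  rewrite -sa mulr_suml; apply: ler_sum => j _; rewrite ler_wpM2l//.
  exact: le_trans (ler_norm _) (fM _ (simplex_vertex v j)).
have tK : t * K < d.
  by rewrite /t mulrAC ltr_pdivrMr// ltr_pM2l// ltrDr.
have : - (t * f x) <= t * `|f x|.
  by rewrite -mulrN (ler_wpM2l (ltW t0))// ler_normr lexx orbT.
move: tK aM; rewrite /K mulrDr /d; lra.
Qed.

(** By upper semicontinuity, a sublevel set is the union of those sets
    {y | forall j, p_j <= coordinate j of y} with rational p that it contains.
    Hence f is Borel measurable on the whole simplex, although it may be
    discontinuous on the boundary. *)
Lemma measurable_fun_convex : measurable_fun (simplex v) f.
Proof.
move=> mT; apply: (measurability _ (RGenInftyO.measurableE R)) => //.
move=> /= _ [_ [c ->] <-].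
pose U (p : {ffun 'I_n.+1 -> rat}) : set 'rV[R]_n :=
  simplex v `&` [set x | forall j, ratr (p j) <= aff_bary v x j].
have mU p : measurable (U p).
  apply: measurableI => //.
  rewrite (_ : mkset _ =
      \bigcap_(j in setT) (aff_bary v ^~ j @^-1` `[ratr (p j), +oo[)).
    apply: fin_bigcap_measurable => // j _.
    by rewrite -[X in measurable X]setTI; exact: measurable_aff_bary.
  apply/seteqP; split => x /= px j.
    by move=> _ /=; rewrite in_itv/= andbT.
  by have := px j I; rewrite /= in_itv/= andbT.
rewrite (_ : _ `&` _ = \bigcup_p
    if `[< forall y, U p y -> f y < c >] then U p else set0).
  apply: countable_bigcupT_measurable; first exact: countableP.
  by move=> p; case: ifP.
apply/seteqP; split => x /=; last first.
  move=> [p _]; case: ifPn => // /asboolP pc Upx.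
  by split; [case: Upx|rewrite /= in_itv/= pc].
move=> [Tx]; rewrite /= in_itv/= => fxc.
have [t /andP[t0 t1] fc] := convex_usc Tx fxc.
have x0 : forall j, 0 <= aff_bary v x j by exact/simplexP.
have /fin_all_exists[p px] : forall j, exists q : rat,
    (1 - t) * aff_bary v x j <= ratr q <= aff_bary v x j.
  (* A vanishing coordinate forces p_j = 0, the only admissible value. *)
  move=> j; have := x0 j; rewrite le_eqVlt => /predU1P[<-|xj0].
    by exists 0; rewrite mulr0 rmorph0 lexx.
  have : (1 - t) * aff_bary v x j < aff_bary v x j.
    by rewrite gtr_pMl// gtrBl.
  move=> /rat_in_itvoo[q]; rewrite in_itv/= => /andP[? ?].
  by exists q; rewrite !ltW.
exists [ffun j => p j] => //; rewrite asboolT.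
  by split=> // j; rewrite ffunE; have /andP[] := px j.
move=> y [Ty py]; apply: fc => // j; apply: le_trans (py j).
by rewrite ffunE; have /andP[] := px j.
Qed.

End convex_measurable.

(** * Averages over a cycle *)

Section cyclic_average.
Context {R : realType} {n : nat} (v : 'I_n.+1 -> 'rV[R]_n) (f : 'rV[R]_n -> R).
Variable sigma : 'S_n.+1.
Hypotheses (simplex_v : simplex_vertices v)
  (convex_f : convex_function (simplex v) f) (cycle_sigma : full_cycle sigma).
Implicit Types (x : 'rV[R]_n).

Lemma sum_full_cycle (V : nmodType) (F : 'I_n.+1 -> V) j :
  \sum_(k < n.+1) F ((sigma ^+ k)%g j) = \sum_i F i.
Proof.
have pT : porbit sigma j = [set: 'I_n.+1]%SET.
  by apply/set1P; rewrite -(eqP cycle_sigma); apply/imsetP; exists j.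
have pn : #|porbit sigma j| = n.+1 by rewrite pT cardsT card_ord.
under eq_bigr do rewrite permX.
rewrite -(big_mkord xpredT (fun k => F (iter k sigma j))).
rewrite (_ : \sum_(0 <= k < n.+1) _ =
    \sum_(i <- traject sigma j n.+1) F i); last first.
  rewrite [RHS](big_nth j) size_traject; apply: eq_big_nat => k kn.
  by rewrite nth_traject.
apply: perm_big; apply: uniq_perm.
- by have := uniq_traject_porbit sigma j; rewrite pn.
- exact: index_enum_uniq.
move=> i; have := porbit_traject sigma j i.
by rewrite pn pT inE mem_index_enum => <-.
Qed.

(** The n + 1 images of x under the powers of the cycle average to the
    barycenter, since each coordinate of x visits every place once. *)
Lemma le_cyclic_average x : simplex v x -> f (barycenter v) <=
  n.+1%:R^-1 * \sum_(k < n.+1) f (aff_perm v (sigma ^+ k)%g x).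
Proof.
move=> Tx.
have k0 (k : 'I_n.+1) : 0 <= n.+1%:R^-1 :> R by rewrite invr_ge0.
have Tk (k : 'I_n.+1) : simplex v (aff_perm v (sigma ^+ k)%g x).
  by rewrite -[simplex v _]/((aff_perm v _ @^-1` simplex v) x) simplex_aff_perm.
have [_] := jensen (convex_simplex (v := v)) convex_f k0 Tk (@sum_inv_card R n).
rewrite -mulr_sumr; congr (f _ <= _).
rewrite -scaler_sumr /aff_perm exchange_big/= barycenterE scaler_sumr.
apply: eq_bigr => j _; rewrite -scaler_suml.
by rewrite (sum_full_cycle (aff_bary v x)) sum_aff_bary scale1r.
Qed.

(** A point y whose coordinates are at least m is the combination of the
    barycenter, with weight (n + 1) m, and of the vertices, with weights
    xi_j - m. Averaged over the cycle, each of these weights becomes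
    1 / (n + 1) - m, and m, a lower bound for all coordinates, is common to all
    the images of x. *)
Lemma cyclic_average_le x m : simplex v x -> 0 <= m ->
  (forall j, m <= aff_bary v x j) ->
  n.+1%:R^-1 * \sum_(k < n.+1) f (aff_perm v (sigma ^+ k)%g x) <=
  vertex_mean f v - n.+1%:R * m * HH_gap f v.
Proof.
move=> Tx m0 mx.
rewrite ler_pdivrMl//.
pose w := n.+1%:R * m.
have w0 : 0 <= w by rewrite mulr_ge0.
have fk k : f (aff_perm v (sigma ^+ k)%g x) <= w * f (barycenter v) +
    \sum_j (aff_bary v x ((sigma ^+ k)%g j) - m) * f (v j).
  pose a j := aff_bary v x ((sigma ^+ k)%g j) - m.
  have a0 j : 0 <= a j by rewrite subr_ge0.
  have aE : w + \sum_j a j = 1.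
    rewrite sumrB sumr_const card_ord -mulr_natl addrC subrK.
    rewrite -[RHS](sum_aff_bary v x).
    by rewrite [RHS](reindex_inj (@perm_inj _ (sigma ^+ k)%g)).
  have := convex_add_vertices convex_f w0 (simplex_barycenter v) a0 aE.
  congr (f _ <= _).
  rewrite barycenterE -scaler_sumr scalerA /w mulrAC mulfV ?pnatr_eq0// mul1r.
  rewrite scaler_sumr -big_split/=; apply: eq_bigr => j _.
  by rewrite scalerBl addrC subrK.
apply: le_trans; first by apply: ler_sum => k _; exact: fk.
rewrite big_split/= exchange_big/= sumr_const card_ord -[X in X + _]mulr_natl.
have -> : \sum_j \sum_(i < n.+1) (aff_bary v x ((sigma ^+ i)%g j) - m) * f (v j)
    = (1 - w) * \sum_j f (v j).
  rewrite mulr_sumr; apply: eq_bigr => j _; rewrite -mulr_suml sumrB.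
  rewrite (sum_full_cycle (aff_bary v x)) sum_aff_bary.
  by rewrite sumr_const card_ord -mulr_natl.
rewrite -/w /HH_gap /vertex_mean.
set N := n.+1%:R; set S := \sum_j _; set c := f _.
have NS : S = N * (N^-1 * S) by rewrite mulrA mulfV ?mul1r// pnatr_eq0.
by rewrite [X in _ + _ * X <= _]NS le_eqVlt; apply/orP; left; apply/eqP; ring.
Qed.

End cyclic_average.

(** * Integration *)

Section lebesgue_borel.
Context {R : realType} {n : nat}.
Local Notation lebesgue_type :=
  (caratheodory_type (mu_ext (borel_lebesgue_rV R n))).

Lemma lebesgue_measurable_set (A : set 'rV[R]_n) : measurable A ->
  measurable (A : set lebesgue_type).
Proof. by move=> mA; apply: sub_caratheodory; exact: sub_sigma_algebra. Qed.

Lemma lebesgue_measurable_fun (D : set 'rV[R]_n) (h : 'rV[R]_n -> R) :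
  measurable D -> measurable_fun D h ->
  measurable_fun (D : set lebesgue_type) (h : lebesgue_type -> R).
Proof. by move=> mD mh _ Y mY; apply: lebesgue_measurable_set; exact: mh. Qed.

End lebesgue_borel.

Section min_barycentric.
Context {R : realType} {n : nat} (v : 'I_n.+1 -> 'rV[R]_n).
Hypothesis simplex_v : simplex_vertices v.

Lemma min_bary_le x j : simplex v x -> min_bary v x <= aff_bary v x j.
Proof. by move=> Tx; rewrite /min_bary baryE//; exact: bigmin_le_cond. Qed.

Lemma min_bary_ge0 x : simplex v x -> 0 <= min_bary v x.
Proof.
move=> Tx; rewrite /min_bary baryE//.
have x0 : forall j, 0 <= aff_bary v x j by exact/simplexP.
by apply/bigmin_geP; split.
Qed.

Lemma measurable_min_bary : measurable_fun (simplex v) (min_bary v).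
Proof.
apply: (eq_measurable_fun
    (fun x => \big[Num.min/aff_bary v x ord0]_j aff_bary v x j)).
  by move=> x; rewrite inE => Tx; rewrite /min_bary baryE.
apply: measurable_funTS; elim: (index_enum _) => [|j r IH].
  by under eq_fun do rewrite big_nil; exact: measurable_aff_bary.
under eq_fun do rewrite big_cons.
by apply: measurable_minr => //; exact: measurable_aff_bary.
Qed.

End min_barycentric.

Lemma Rintegral_sum d (T : measurableType d) (R : realType)
    (m : {measure set T -> \bar R}) (D : set T) (I : Type) (r : seq I)
    (h : I -> T -> R) : measurable D ->
  (forall i, m.-integrable D (EFin \o h i)) ->
  m.-integrable D (EFin \o (fun x => \sum_(i <- r) h i x)) /\
  \int[m]_(x in D) (\sum_(i <- r) h i x) = \sum_(i <- r) \int[m]_(x in D) h i x.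
Proof.
move=> mD ih; elim: r => [|i r [IHi IHe]].
  split.
    rewrite (_ : _ \o _ = cst 0%E); first exact: integrable0.
    by apply/funext => x /=; rewrite big_nil.
  under eq_Rintegral do rewrite big_nil.
  by rewrite big_nil Rintegral_cst// mul0r.
split.
  rewrite (_ : _ \o _ = ((EFin \o h i) \+
      (EFin \o (fun x => \sum_(i <- r) h i x)%R))%E).
    exact: integrableD.
  by apply/funext => x /=; rewrite big_cons.
under eq_Rintegral do rewrite big_cons.
by rewrite RintegralD// big_cons IHe.
Qed.

Theorem theorem8 (R : realType) (n : nat) (v : 'I_n.+1 -> 'rV[R]_n)
    (f g : 'rV[R]_n -> R) (sigma : 'S_n.+1)
    (n_ge1 : (1 <= n)%N)
    (simplex_v : simplex_vertices v)
    (convex_f : convex_function (simplex v) f)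
    (g_ge0 : forall x, simplex v x -> 0 <= g x)
    (integrable_g : (lebesgue_rV n).-integrable (simplex v) (EFin \o g))
    (cycle_sigma : full_cycle sigma)
    (sigma_g : forall x, simplex v x -> g (simplex_perm v sigma x) = g x) :
  (0 <= HH_gap f v * simplex_integral v (fun x => g x * (n.+1%:R * min_bary v x))
     <= HH_right f v g)
  /\
  (0 <= HH_left f v g
     <= HH_gap f v * simplex_integral v (fun x => g x * (1 - n.+1%:R * min_bary v x))).
Proof.
pose m := @min_bary R n v; pose N : R := n.+1%:R.
pose Pk (k : nat) := aff_perm v (sigma ^+ k)%g.
have mT := measurable_simplex simplex_v.
have LmT := lebesgue_measurable_set mT.
have TP k x : simplex v x -> simplex v (Pk k x).
  move=> Tx; rewrite -[simplex v _]/((Pk k @^-1` simplex v) x).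
  by rewrite simplex_aff_perm.
have gP k x : simplex v x -> g (Pk k x) = g x.
  elim: k => [|k IH] Tx; first by rewrite /Pk expg0 aff_perm1.
  rewrite /Pk expgS aff_permM// -simplex_permE ?sigma_g ?IH//; exact: TP.
have int_bounded (h : 'rV[R]_n -> R) M : measurable_fun (simplex v) h ->
    (forall x, simplex v x -> `|h x| <= M) ->
    (lebesgue_rV n).-integrable (simplex v) (EFin \o (fun x => h x * g x)).
  move=> mh hM.
  have := integrableMr LmT (lebesgue_measurable_fun mT mh) _ integrable_g.
  apply; exists M; split; first exact: num_real.
  by move=> M' MM' x Tx; apply: (le_trans (hM _ Tx)); exact: ltW.
have [M fM] := convex_bounded simplex_v convex_f.
have ifg := int_bounded f M (measurable_fun_convex simplex_v convex_f) fM.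
have im : (lebesgue_rV n).-integrable (simplex v)
    (EFin \o (fun x => g x * (N * m x))).
  rewrite (_ : (fun x => _) = (fun x => N * m x * g x)); last first.
    by apply/funext => x; rewrite mulrC.
  apply: (int_bounded _ N) => [|x Tx].
    by apply: measurable_funM => //; exact: measurable_min_bary.
  have m0 : 0 <= m x by exact: min_bary_ge0.
  rewrite ger0_norm ?mulr_ge0// -[leRHS]mulr1 ler_wpM2l//.
  apply: (le_trans (min_bary_le simplex_v ord0 Tx)).
  have x0 : forall j, 0 <= aff_bary v x j by exact/simplexP.
  by rewrite -(sum_aff_bary v x) (bigD1 ord0)//= lerDl sumr_ge0.
have presP s : borel_preserving (aff_perm v s).
  by split; [exact: measurable_aff_perm|exact: borel_lebesgue_aff_perm].
(* Substituting the k-th power of the map, which leaves g unchanged. *)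
have shift k : (lebesgue_rV n).-integrable (simplex v)
      (EFin \o (fun x => f (Pk k x) * g x)) /\
    simplex_integral v (fun x => f (Pk k x) * g x) =
    simplex_integral v (fun x => f x * g x).
  have PK : cancel (Pk k) (aff_perm v (sigma ^+ k)^-1%g).
    by move=> x; rewrite /Pk -aff_permM// mulVg aff_perm1.
  have PVK : cancel (aff_perm v (sigma ^+ k)^-1%g) (Pk k).
    by move=> x; rewrite /Pk -aff_permM// mulgV aff_perm1.
  have [iP eP] := integral_lebesgue_preserving (presP _) (presP _) PK PVK LmT
    (simplex_aff_perm simplex_v _) ifg.
  split.
    apply: eq_integrable iP => // x; rewrite inE => Tx /=.
    by rewrite gP.
  rewrite /simplex_integral -eP; apply: eq_Rintegral => x; rewrite inE => Tx.
  by rewrite gP.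
(* F / (n + 1) is the average over the cycle, with the same integral as f g. *)
pose A := simplex_integral v (fun x => f x * g x).
pose G := simplex_integral v g.
pose W := simplex_integral v (fun x => g x * (N * m x)).
pose F x := \sum_(k < n.+1) f (Pk k x) * g x.
have [iF eF] := Rintegral_sum (index_enum 'I_n.+1) LmT
  (fun k : 'I_n.+1 => (shift k).1).
have avgE : simplex_integral v (fun x => N^-1 * F x) = A.
  rewrite /simplex_integral RintegralZl// eF.
  rewrite (eq_bigr (fun=> A)); last by move=> k _; exact: (shift k).2.
  by rewrite sumr_const card_ord -mulr_natl mulrA mulVf ?mul1r// pnatr_eq0.
have iNF : (lebesgue_rV n).-integrable (simplex v)
    (EFin \o (fun x => N^-1 * F x)).
  have := @integrableZl _ _ _ _ _ LmT N^-1 _ iF.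
  exact.
have W1 : simplex_integral v (fun x => g x * (1 - N * m x)) = G - W.
  rewrite /simplex_integral -RintegralB//; apply: eq_Rintegral => x _.
  by rewrite mulrBr mulr1.
have lower : f (barycenter v) * G <= A.
  rewrite -avgE /G /simplex_integral -RintegralZl//.
  apply: le_Rintegral => //.
    exact: (@integrableZl _ _ _ _ _ LmT _ _ integrable_g).
  move=> x Tx; rewrite /F -mulr_suml mulrA ler_wpM2r ?g_ge0//.
  exact: le_cyclic_average.
have iup : (lebesgue_rV n).-integrable (simplex v)
    (EFin \o (fun x => vertex_mean f v * g x - HH_gap f v * (g x * (N * m x)))).
  have := integrableB LmT
    (@integrableZl _ _ _ _ _ LmT (vertex_mean f v) _ integrable_g)
    (@integrableZl _ _ _ _ _ LmT (HH_gap f v) _ im).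
  exact.
have upper : A <= vertex_mean f v * G - HH_gap f v * W.
  rewrite -avgE /G /W /simplex_integral -!RintegralZl// -RintegralB//;
    last 2 first.
    exact: (@integrableZl _ _ _ _ _ LmT _ _ integrable_g).
    exact: (@integrableZl _ _ _ _ _ LmT _ _ im).
  apply: le_Rintegral => // x Tx.
  rewrite /F -mulr_suml [leLHS]mulrA.
  rewrite (_ : _ - _ = (vertex_mean f v - N * m x * HH_gap f v) * g x);
    last by ring.
  apply: ler_wpM2r; first exact: g_ge0.
  apply: cyclic_average_le => //.
    exact: min_bary_ge0.
  by move=> j; exact: min_bary_le.
have gap0 := HH_gap_ge0 convex_f.
have W0 : 0 <= W.
  apply: Rintegral_ge0 => x Tx; rewrite mulr_ge0 ?g_ge0// mulr_ge0//.
  exact: min_bary_ge0.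
rewrite -/N -/W /HH_right /HH_left -/A -/G W1.
split; apply/andP; split.
- exact: mulr_ge0.
- by rewrite lerBrDr addrC -lerBrDr.
- by rewrite subr_ge0.
- apply: (le_trans (lerB upper (lexx _))); rewrite le_eqVlt; apply/orP; left.
  by apply/eqP; rewrite /HH_gap; ring.
Qed.
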